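(* Let $n\ge 1$ and let $K_{n,n}:(\sigma,\mu)$ be a strong fuzzy graph whose underlying crisp graph is the complete bipartite graph with both parts of size $n$ and such that $\sigma$ is a $c$-constant function. Then $K_{n,n}$ is *-balanced.
   Context: A fuzzy graph $G:(\sigma,\mu)$ consists of a finite non-empty vertex set $V$, a function $\sigma:V\to(0,1]$, and a symmetric function $\mu:V\times V\to[0,1]$ with $\mu(u,v)\le \sigma(u)\wedge\sigma(v)$ for all $u,v$, where $\wedge$ denotes minimum. There are no loops: all conditions and sums over pairs $u,v\in V$ range over unordered pairs $\{u,v\}$ of distinct vertices. The underlying crisp graph of $G$ has vertex set $V$ and edge set $E=\{\{u,v\}:\mu(u,v)>0\}$. $G$ is strong if $\mu(u,v)=\sigma(u)\wedge\sigma(v)$ for all $\{u,v\}\in E$. $\sigma$ is a $c$-constant function if $\sigma(v)=c$ for all $v\in V$ (so $c\in(0,1]$). The *-density of $G$ is $D^{\ast}(G)=\dfrac{2\sum_{u,v\in V}\mu(u,v)}{\sum_{u\in V}\sigma(u)}$. A non-empty fuzzy subgraph of $G$ is a fuzzy graph $H:(\sigma',\mu')$ on a non-empty set $W\subseteq V$ with $\sigma'(u)\le\sigma(u)$ and $\mu'(u,v)\le\mu(u,v)$ for all $u,v\in W$. $G$ is *-balanced if $D^{\ast}(H)\le D^{\ast}(G)$ for all non-empty fuzzy subgraphs $H$ of $G$. *)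

(* Defs.v *)
From mathcomp Require Export all_boot all_order all_algebra reals.

Set Implicit Arguments.
Unset Strict Implicit.
Unset Printing Implicit Defensive.

Import Order.TTheory GRing.Theory Num.Theory.
Local Open Scope ring_scope.

(* The vertex set is a subset of an ambient finite type [T], so that a graph
   and its subgraphs on smaller vertex sets have the same type. The values of
   [sigma] and [mu] outside the vertex set, and those of [mu] on the diagonal,
   are unconstrained and never used. *)
Record fuzzyGraph (R : realType) (T : finType) := FuzzyGraph {
  vset : {set T};
  sigma : T -> R;
  mu : T -> T -> R;
  vset_neq0 : vset != set0;
  sigma_range : forall v, v \in vset -> 0 < sigma v <= 1;
  mu_sym : forall u v, u \in vset -> v \in vset -> u != v -> mu u v = mu v u;
  mu_range : forall u v, u \in vset -> v \in vset -> u != v ->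
    0 <= mu u v <= 1;
  mu_le_min : forall u v, u \in vset -> v \in vset -> u != v ->
    mu u v <= Num.min (sigma u) (sigma v)
}.

Section FuzzyGraphs.
Variables (R : realType) (T : finType).
Implicit Types G H : fuzzyGraph R T.

Definition crisp_edges G : {set {set T}} :=
  [set [set u; v] | u in vset G, v in vset G & (u != v) && (0 < mu G u v)].

Definition complete_bipartite (V : {set T}) (E : {set {set T}}) (m n : nat) :
    Prop :=
  exists A B : {set T},
    [/\ A :|: B = V, [disjoint A & B], #|A| = m, #|B| = n &
        E = [set [set a; b] | a in A, b in B]].

Definition strong G : Prop :=
  forall u v, u \in vset G -> v \in vset G -> u != v ->
    [set u; v] \in crisp_edges G -> mu G u v = Num.min (sigma G u) (sigma G v).

Definition sigma_constant G (c : R) : Prop :=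
  forall v, v \in vset G -> sigma G v = c.

(* Each unordered pair of distinct vertices contributes one summand, listed in
   the order of the enumeration of [T]; by symmetry of [mu] the order is
   immaterial. *)
Definition sum_mu G : R :=
  \sum_(u in vset G) \sum_(v in vset G | (enum_rank u < enum_rank v)%N)
    mu G u v.

Definition star_density G : R :=
  2 * sum_mu G / \sum_(u in vset G) sigma G u.

Definition fuzzy_subgraph H G : Prop :=
  [/\ vset H \subset vset G,
      forall u, u \in vset H -> sigma H u <= sigma G u &
      forall u v, u \in vset H -> v \in vset H -> u != v ->
        mu H u v <= mu G u v].

Definition star_balanced G : Prop :=
  forall H, fuzzy_subgraph H G -> star_density H <= star_density G.

End FuzzyGraphs.

(* Main.v *)
Require Import Defs.

Set Implicit Arguments.
Unset Strict Implicit.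
Unset Printing Implicit Defensive.

Import Order.TTheory GRing.Theory Num.Theory.
Local Open Scope ring_scope.

(** Counting every edge from both ends, twice the total edge weight is the sum
    over the vertices [u] of the weights of the edges at [u]. Each of these
    weights is at most [sigma u], so a fuzzy graph whose crisp degrees are at
    most [d] has *-density at most [d] ([star_density_le_degree]). If the graph
    is strong with constant [sigma], the weights at [u] are equal to [sigma u],
    so that crisp [d]-regularity forces the *-density to be exactly [d]
    ([star_density_regular]). Passing to a fuzzy subgraph can only remove crisp
    edges, so the *-density of a subgraph of a [d]-regular graph is at most [d]:
    every strong, constant, crisply regular fuzzy graph is *-balanced
    ([regular_star_balanced]). The complete bipartite graph with parts of size
    [n] is [n]-regular, since the neighbours of a vertex are the vertices of the
    other part. *)

Section Neighbourhoods.
Variables (R : realType) (T : finType).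
Implicit Types G H : fuzzyGraph R T.

Definition neighbours G (u : T) : {set T} :=
  [set v in vset G | (u != v) && (0 < mu G u v)].

(** [enum_rank] is injective, so the pairs listed by [sum_mu] and their mirror
    images exhaust the ordered pairs of distinct vertices. *)
Lemma double_sum_mu G :
  2 * sum_mu G = \sum_(u in vset G) \sum_(v in vset G | u != v) mu G u v.
Proof.
have mirror : sum_mu G = \sum_(u in vset G)
    \sum_(v in vset G | (enum_rank v < enum_rank u)%N) mu G u v.
  rewrite /sum_mu (exchange_big_dep (mem (vset G))) /=; last first.
    by move=> u v _ /andP[].
  apply: eq_bigr => u uG; apply: eq_big => [v|v /and3P[vG _ vu]].
    by rewrite uG.
  by apply: mu_sym => //; apply: contraTneq vu => ->; rewrite ltnn.
rewrite mulr_natl mulr2n {2}mirror -big_split; apply: eq_bigr => u uG /=.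
rewrite [RHS](bigID (fun v => (enum_rank u < enum_rank v)%N)) /=.
have rankE v : (u != v) = (enum_rank u != enum_rank v :> nat).
  by rewrite (inj_eq val_inj) (inj_eq enum_rank_inj).
congr (_ + _); apply: eq_bigl => v; rewrite rankE -andbA;
  by case: ltngtP; rewrite ?andbF ?andbT.
Qed.

Lemma double_sum_mu_neighbours G :
  2 * sum_mu G = \sum_(u in vset G) \sum_(v in neighbours G u) mu G u v.
Proof.
rewrite double_sum_mu; apply: eq_bigr => u uG.
rewrite (bigID (fun v => 0 < mu G u v)) /= [X in _ + X]big1 ?addr0.
  by apply: eq_bigl => v; rewrite inE andbA.
move=> v /andP[/andP[vG uv]]; have /andP[mu0 _] := mu_range uG vG uv.
by rewrite lt_def mu0 andbT negbK => /eqP.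
Qed.

Lemma sum_sigma_gt0 G : 0 < \sum_(u in vset G) sigma G u.
Proof.
have /set0Pn[u uG] := vset_neq0 G.
have sigma0 v : v \in vset G -> 0 < sigma G v by case/sigma_range/andP.
rewrite (bigD1 u) //= ltr_wpDr ?sigma0 //.
by apply: sumr_ge0 => v /andP[/sigma0/ltW].
Qed.

(** Bounding an edge weight [mu u v] by [sigma u] alone, rather than by the
    minimum, turns the inner sum into a multiple of [sigma u], and then
    [sum sigma] cancels. *)
Lemma star_density_le_degree G (d : nat) :
  (forall u, u \in vset G -> #|neighbours G u| <= d)%N ->
  star_density G <= d%:R.
Proof.
move=> deg; rewrite /star_density ler_pdivrMr ?sum_sigma_gt0 //.
rewrite double_sum_mu_neighbours mulr_sumr; apply: ler_sum => u uG.
have /andP[/ltW sigma0 _] := sigma_range uG.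
apply: (@le_trans _ _ (\sum_(v in neighbours G u) sigma G u)).
  apply: ler_sum => v; rewrite inE => /and3P[vG uv _].
  by have := mu_le_min uG vG uv; rewrite le_min => /andP[].
by rewrite sumr_const mulr_natl ler_wpMn2l ?deg.
Qed.

(** A crisp edge does not remember the order of its ends, so the symmetry of
    [mu] is what makes this hold. *)
Lemma crisp_edges_neighbours G u v :
  u \in vset G -> v \in vset G -> u != v ->
  ([set u; v] \in crisp_edges G) = (v \in neighbours G u).
Proof.
move=> uG vG uv; rewrite inE vG uv /=.
apply/imset2P/idP => [[a b aG]|mu0]; last first.
  by exists u v => //; rewrite inE vG uv.
rewrite inE => /and3P[bG ab mu0] E.
have : u \in [set a; b] by rewrite -E !inE eqxx.
have : v \in [set a; b] by rewrite -E !inE eqxx orbT.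
rewrite !inE => /orP[]/eqP vE /orP[]/eqP uE; subst; rewrite ?eqxx // in uv *.
by rewrite mu_sym.
Qed.

(** The bound [mu u v <= sigma u] is attained on every edge when
    [sigma u = sigma v]. *)
Lemma star_density_regular G (d : nat) (c : R) :
  strong G -> sigma_constant G c ->
  (forall u, u \in vset G -> #|neighbours G u| = d) ->
  star_density G = d%:R.
Proof.
move=> strG sigc deg; rewrite /star_density.
apply: (canLR (mulfK _)); first by rewrite gt_eqF ?sum_sigma_gt0.
rewrite double_sum_mu_neighbours mulr_sumr; apply: eq_bigr => u uG.
rewrite -(deg u uG) mulr_natl -sumr_const; apply: eq_bigr => v uNv.
have := uNv; rewrite inE => /and3P[vG uv _].
by rewrite strG ?crisp_edges_neighbours // !sigc // minxx.
Qed.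

Lemma subgraph_neighbours H G u :
  fuzzy_subgraph H G -> u \in vset H -> neighbours H u \subset neighbours G u.
Proof.
move=> [/subsetP sHG _ muHG] uH; apply/subsetP => v.
rewrite !inE => /and3P[vH uv mu0]; rewrite sHG // uv /=.
exact: lt_le_trans mu0 (muHG _ _ uH vH uv).
Qed.

(** The degree bound of [G] holds for each subgraph, whereas [G] itself attains
    the *-density [d] that this bound allows. *)
Lemma regular_star_balanced G (d : nat) (c : R) :
  strong G -> sigma_constant G c ->
  (forall u, u \in vset G -> #|neighbours G u| = d) ->
  star_balanced G.
Proof.
move=> strG sigc deg H sHG; rewrite (star_density_regular strG sigc deg).
apply: star_density_le_degree => u uH; have [/subsetP sV _ _] := sHG.
by rewrite -(deg u (sV u uH)) subset_leq_card // subgraph_neighbours.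
Qed.

(** The hypotheses on [A] and [B] are symmetric, so this also determines the
    neighbours of the vertices of [B]. *)
Lemma neighbours_bipartite G (A B : {set T}) a :
  A :|: B = vset G -> [disjoint A & B] ->
  crisp_edges G = [set [set x; y] | x in A, y in B] ->
  a \in A -> neighbours G a = B.
Proof.
move=> VE dAB EE aA; have aG : a \in vset G by rewrite -VE inE aA.
apply/setP => v; apply/idP/idP => [aNv|vB].
  have := aNv; rewrite inE => /and3P[vG av _].
  move: aNv; rewrite -crisp_edges_neighbours // EE => /imset2P[x y xA yB E].
  have : y \in [set a; v] by rewrite E !inE eqxx orbT.
  rewrite !inE => /orP[]/eqP yE; last by rewrite -yE.
  by have := disjointFr dAB aA; rewrite -yE yB.
have vG : v \in vset G by rewrite -VE inE vB orbT.
have av : a != v by apply: contraTneq vB => <-; rewrite (disjointFr dAB aA).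
by rewrite -crisp_edges_neighbours // EE; apply/imset2P; exists a v.
Qed.

Lemma complete_bipartite_edges_sym (A B : {set T}) :
  [set [set x; y] | x in A, y in B] = [set [set x; y] | x in B, y in A].
Proof.
by apply/setP => e; apply/imset2P/imset2P => -[x y xP yP ->]; exists y x;
  rewrite // setUC.
Qed.

Lemma complete_bipartite_regular G (n : nat) :
  complete_bipartite (vset G) (crisp_edges G) n n ->
  forall u, u \in vset G -> #|neighbours G u| = n.
Proof.
move=> [A [B [VE dAB cA cB EE]]] u; rewrite -VE inE => /orP[uA|uB].
  by rewrite (neighbours_bipartite VE dAB EE uA).
rewrite (@neighbours_bipartite _ B A) // 1?setUC // 1?disjoint_sym //.
by rewrite EE complete_bipartite_edges_sym.
Qed.

End Neighbourhoods.

Theorem theorem11 (R : realType) (T : finType) (n : nat) (c : R)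
    (K : fuzzyGraph R T) :
  (1 <= n)%N ->
  complete_bipartite (vset K) (crisp_edges K) n n ->
  strong K ->
  sigma_constant K c ->
  star_balanced K.
Proof.
move=> _ /complete_bipartite_regular degK strK sigK.
exact: regular_star_balanced strK sigK degK.
Qed.
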